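(* Let $M_i$ be an $R_i$-module for each $i=1,2,\dots,n$. Suppose that $R=R_1\times R_2\times\cdots\times R_n$ and $M=M_1\times M_2\times\cdots\times M_n$, viewed as an $R$-module with componentwise operations. The following statements are equivalent: (i) $M$ is a regular fusible $R$-module. (ii) $M_i$ is a regular fusible $R_i$-module for every $i=1,2,\dots,n$.
   Context: Rings are associative with identity, not necessarily commutative; modules are unital right modules. For a right $R$-module $M$ and $m\in M$, $ann_R(m)=\{r\in R: mr=0\}$. $T_R(M)=\{m\in M: ann_R(m)\neq 0\}$ is the set of torsion elements, $T_R^{\star}(M)=\{m\in M: ann_R(m)=0\}$ the set of torsion free elements, and $Zd(M)=\{r\in R: mr=0\text{ for some }0\neq m\in M\}$. An element of $M$ is fusible if it can be written as $x+y$ with $x\in T_R(M)$ and $y\in T_R^{\star}(M)$. A nonzero $m\in M$ is regular fusible if there exists $r\in R-Zd(M)$ such that $mr$ is fusible; $M$ is a regular fusible $R$-module if every nonzero element of $M$ is regular fusible.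
   Formalization: For (ii) ⇒ (i) it is additionally assumed that M_i is nonzero whenever R_i is nonzero; without this the claim fails, e.g. R_1 = R_2 = Z, M_1 = 0, M_2 = Z, where M has no torsion free element. (i) ⇒ (ii) needs no extra assumption. *)

(* Defs.v *)
From HB Require Import structures.
From mathcomp Require Import all_boot all_algebra.

Set Implicit Arguments.
Unset Strict Implicit.
Unset Printing Implicit Defensive.

Import GRing.Theory.
Local Open Scope ring_scope.

(* Plain MathComp.  A right R-module is a left module over the
   converse ring R^c; the type pzRingType does not impose commutativity, nor
   1 <> 0. *)
Notation rightModType R := (lmodType R^c).

Definition ract (R : pzRingType) (M : rightModType R) (m : M) (r : R) : M :=
  (r : R^c) *: m.

Notation "m *> r" := (ract m r) (at level 40, left associativity) : ring_scope.

Section RegularFusible.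

Variables (R : pzRingType) (M : rightModType R).

Definition ann (m : M) (r : R) : Prop := m *> r = 0.

(* As 0 always lies in the annihilator, it is nonzero iff it contains a nonzero
   element. *)
Definition torsion (m : M) : Prop := exists2 r : R, ann m r & r <> 0.

Definition torsion_free (m : M) : Prop := forall r : R, ann m r -> r = 0.

Definition Zd (r : R) : Prop := exists2 m : M, m <> 0 & m *> r = 0.

Definition fusible (m : M) : Prop :=
  exists x y : M, [/\ torsion x, torsion_free y & m = x + y].

Definition regular_fusible_elt (m : M) : Prop :=
  m <> 0 /\ exists2 r : R, ~ Zd r & fusible (m *> r).

Definition regular_fusible : Prop :=
  forall m : M, m <> 0 -> regular_fusible_elt m.

End RegularFusible.

Arguments regular_fusible {R} M.

Section ProductZmodule.

Variables (I : finType) (V : I -> zmodType).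
Local Notation prodV := {dffun forall i : I, V i}.
Implicit Types f g : prodV.

Definition dffun_zero : prodV := [ffun i => 0 : V i].
Definition dffun_opp f : prodV := [ffun i => - f i].
Definition dffun_add f g : prodV := [ffun i => f i + g i].

Fact dffun_addA : associative dffun_add.
Proof. by move=> f g h; apply/ffunP=> i; rewrite !ffunE addrA. Qed.
Fact dffun_addC : commutative dffun_add.
Proof. by move=> f g; apply/ffunP=> i; rewrite !ffunE addrC. Qed.
Fact dffun_add0 : left_id dffun_zero dffun_add.
Proof. by move=> f; apply/ffunP=> i; rewrite !ffunE add0r. Qed.
Fact dffun_addN : left_inverse dffun_zero dffun_opp dffun_add.
Proof. by move=> f; apply/ffunP=> i; rewrite !ffunE addNr. Qed.

HB.instance Definition _ := GRing.isZmodule.Build prodV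
  dffun_addA dffun_addC dffun_add0 dffun_addN.

End ProductZmodule.

Section ProductRing.

Variables (I : finType) (R : I -> pzRingType).
Local Notation prodR := {dffun forall i : I, R i}.
Implicit Types f g : prodR.

Definition dffun_one : prodR := [ffun i => 1 : R i].
Definition dffun_mul f g : prodR := [ffun i => f i * g i].

Fact dffun_mulA : associative dffun_mul.
Proof. by move=> f g h; apply/ffunP=> i; rewrite !ffunE mulrA. Qed.
Fact dffun_mul1l : left_id dffun_one dffun_mul.
Proof. by move=> f; apply/ffunP=> i; rewrite !ffunE mul1r. Qed.
Fact dffun_mul1r : right_id dffun_one dffun_mul.
Proof. by move=> f; apply/ffunP=> i; rewrite !ffunE mulr1. Qed.
Fact dffun_mulDl : left_distributive dffun_mul +%R.
Proof. by move=> f g h; apply/ffunP=> i; rewrite !ffunE mulrDl. Qed.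
Fact dffun_mulDr : right_distributive dffun_mul +%R.
Proof. by move=> f g h; apply/ffunP=> i; rewrite !ffunE mulrDr. Qed.

HB.instance Definition _ := GRing.Zmodule_isPzRing.Build prodR
  dffun_mulA dffun_mul1l dffun_mul1r dffun_mulDl dffun_mulDr.

End ProductRing.

Section ProductModule.

Variables (I : finType) (R : I -> pzRingType).
Variable M : forall i : I, rightModType (R i).
Local Notation prodR := {dffun forall i : I, R i}.
Local Notation prodM := {dffun forall i : I, M i}.

Definition dffun_ract (r : prodR^c) (m : prodM) : prodM :=
  [ffun i => m i *> (r : prodR) i].

Fact dffun_ractA (r s : prodR^c) m :
  dffun_ract r (dffun_ract s m) = dffun_ract (r * s) m.
Proof. by apply/ffunP=> i; rewrite !ffunE /ract scalerA. Qed.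
Fact dffun_ract1 : left_id (1 : prodR^c) dffun_ract.
Proof. by move=> m; apply/ffunP=> i; rewrite !ffunE /ract scale1r. Qed.
Fact dffun_ractDr : right_distributive dffun_ract +%R.
Proof. by move=> r m p; apply/ffunP=> i; rewrite !ffunE /ract scalerDr. Qed.
Fact dffun_ractDl m : {morph dffun_ract^~ m : r s / r + s}.
Proof. by move=> r s; apply/ffunP=> i; rewrite !ffunE /ract scalerDl. Qed.

HB.instance Definition _ := GRing.Zmodule_isLmodule.Build prodR^c prodM
  dffun_ractA dffun_ract1 dffun_ractDr dffun_ractDl.

End ProductModule.

(* Main.v *)
Require Import Defs.
From mathcomp Require Import all_boot all_algebra.
Import GRing.Theory.
Local Open Scope ring_scope.

(** Annihilators in a product are computed componentwise.  Hence an element of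
    the product is torsion iff SOME component is torsion, it is torsion free
    iff ALL components are, and a scalar lies in [Zd] iff some component does.
    A decomposition [m = x + y] witnessing fusibility of [m] therefore amounts
    to torsion free elements [y i] of all the factors such that [m i - y i] is
    torsion for at least one [i] (lemma [fusible_dffun]).

    From the product to the factors: apply regular fusibility to the element
    supported at [i] with value [a].  For [j] distinct from [i], its [j]-th
    component stays [0] after multiplication by a scalar, and [0] is never
    fusible: [0 = x + y] forces [x = - y], which has the same annihilator as
    [y].  So the fusible component has to be the [i]-th one, [a *> r i].

    From the factors to the product: pick [i] with [m i] nonzero and a scalar
    [r] outside [Zd (M i)] with [m i *> r] fusible; use [r] at [i] and [1] at
    the other indices.  The factor [i] supplies the torsion component, so all
    that is needed from the other factors is a torsion free element.  A nonzero
    regular fusible module has one; over the zero ring, [0] is one. *)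

Section RightModule.

Context {R : pzRingType} {M : rightModType R}.
Implicit Types (m x y : M) (r : R).

Lemma ract0l r : (0 : M) *> r = 0.
Proof. exact: scaler0. Qed.

Lemma ract1 m : m *> (1 : R) = m.
Proof. exact: scale1r. Qed.

Lemma ract0 m : m *> (0 : R) = 0.
Proof. exact: scale0r. Qed.

Lemma ractNl m r : (- m) *> r = - (m *> r).
Proof. exact: scalerN. Qed.

Lemma torsion_free_opp y : torsion_free y -> torsion_free (- y).
Proof.
move=> yF r; rewrite /ann ractNl => /eqP; rewrite oppr_eq0 => /eqP.
exact: yF.
Qed.

Lemma torsion_not_free m : torsion m -> ~ torsion_free m.
Proof. by move=> [r mr0 r_neq0] /(_ r mr0). Qed.

Lemma not_fusible0 : ~ fusible (0 : M).
Proof.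
move=> [x [y [xT yF]]] /esym /eqP; rewrite addr_eq0 => /eqP xE.
by apply: (torsion_not_free _ xT); rewrite xE; apply: torsion_free_opp.
Qed.

Lemma not_Zd1 : ~ Zd M (1 : R).
Proof. by move=> [m m_neq0]; rewrite ract1. Qed.

Lemma fusible_torsion_free m : fusible m -> exists y : M, torsion_free y.
Proof. by move=> [x [y [_ yF _]]]; exists y. Qed.

(** The hypothesis excludes a zero module over a nonzero ring, the only regular
    fusible modules without torsion free elements. *)
Lemma regular_fusible_torsion_free :
    ((1 : R) <> 0 -> exists m : M, m <> 0) ->
  regular_fusible M -> exists y : M, torsion_free y.
Proof.
move=> nontriv rfM; have [R0|/eqP/nontriv[m m_neq0]] := eqVneq (1 : R) 0.
  by exists 0 => r _; rewrite -[r]mul1r R0 mul0r.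
by have [_ [r _ /fusible_torsion_free]] := rfM m m_neq0.
Qed.

End RightModule.

Section ProductElement.

Context {I : finType} {V : I -> zmodType}.
Local Notation prodV := {dffun forall i : I, V i}.

Lemma dffun_neq0 (f : prodV) : f <> 0 -> exists i, f i <> 0.
Proof.
move=> f_neq0; have [/existsP[i /eqP fi]|/existsPn f0] :=
  boolP [exists i, f i != 0]; first by exists i.
by case: f_neq0; apply/ffunP=> i; rewrite ffunE; apply/eqP/negPn/f0.
Qed.

Lemma dffun_comp_neq0 (f : prodV) i : f i <> 0 -> f <> 0.
Proof. by move=> fi_neq0 f0; apply: fi_neq0; rewrite f0 ffunE. Qed.

Definition dffun_single (i : I) (a : V i) : prodV :=
  [ffun j => dfwith (fun k => 0 : V k) a j].

Lemma dffun_single_in i (a : V i) : dffun_single i a i = a.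
Proof. by rewrite ffunE dfwith_in. Qed.

Lemma dffun_single_out i j (a : V i) : i != j -> dffun_single i a j = 0.
Proof. by move=> ij; rewrite ffunE dfwith_out. Qed.

Lemma dffun_single_neq0 i (a : V i) : a <> 0 -> dffun_single i a <> 0.
Proof. by move=> a_neq0; apply: (@dffun_comp_neq0 _ i); rewrite dffun_single_in. Qed.

End ProductElement.

Section ProductTorsion.

Context {I : finType} {R : I -> pzRingType}.
Context {M : forall i : I, rightModType (R i)}.
Local Notation prodR := ({dffun forall i : I, R i} : pzRingType).
Local Notation prodM := ({dffun forall i : I, M i} : rightModType prodR).
Implicit Types (m x y : prodM) (r : prodR).

Lemma ract_dffunE m r i : (m *> r) i = m i *> r i.
Proof. by rewrite {1}/ract ffunE. Qed.

Lemma ann_dffun m r : ann m r <-> forall i, ann (m i) (r i).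
Proof.
split=> [mr0 i | mr0]; first by rewrite /ann -ract_dffunE mr0 ffunE.
by apply/ffunP=> i; rewrite ract_dffunE mr0 ffunE.
Qed.

Lemma torsion_dffun m : torsion m <-> exists i, torsion (m i).
Proof.
split=> [[r /ann_dffun mr0 /dffun_neq0[i ri_neq0]] | [i [a ma0 a_neq0]]].
  by exists i, (r i).
exists (dffun_single i a); last exact: dffun_single_neq0.
apply/ann_dffun=> j; have [<-|ij] := eqVneq i j; first by rewrite dffun_single_in.
by rewrite dffun_single_out // /ann ract0.
Qed.

Lemma torsion_free_dffun m : torsion_free m <-> forall i, torsion_free (m i).
Proof.
split=> [mF i a ma0 | mF r /ann_dffun mr0]; last first.
  by apply/ffunP=> i; rewrite ffunE; apply: mF.
rewrite -(dffun_single_in (V := R) i a) (mF (dffun_single i a)) ?ffunE //.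
apply/ann_dffun=> j; have [<-|ij] := eqVneq i j; first by rewrite dffun_single_in.
by rewrite dffun_single_out // /ann ract0.
Qed.

Lemma Zd_dffun r : Zd prodM r <-> exists i, Zd (M i) (r i).
Proof.
split=> [[m /dffun_neq0[i mi_neq0] /ann_dffun mr0] | [i [a a_neq0 ar0]]].
  by exists i, (m i) => //; apply: mr0.
exists (dffun_single i a); first exact: dffun_single_neq0.
apply/ann_dffun=> j; have [<-|ij] := eqVneq i j; first by rewrite dffun_single_in.
by rewrite dffun_single_out // /ann ract0l.
Qed.

(** A single fusible component suffices: the other components of [m - y] are
    unconstrained, because a product element is torsion as soon as one of its
    components is. *)
Lemma fusible_dffun m :
  fusible m <->
  (exists i, fusible (m i)) /\ (forall i, exists y : M i, torsion_free y).
Proof.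
split=> [[x [y [/torsion_dffun[i xT] /torsion_free_dffun yF mE]]] |].
  split=> [|j]; last by exists (y j).
  by exists i, (x i), (y i); rewrite mE ffunE.
move=> [[i [a [b [aT bF mE]]]] /fin_all_exists[z zF]].
pose y : prodM := [ffun j => dfwith z b j].
exists (m - y), y; split; last by rewrite subrK.
  by apply/torsion_dffun; exists i; rewrite !ffunE dfwith_in mE addrK.
apply/torsion_free_dffun=> j; rewrite ffunE.
have [<-|ij] := eqVneq i j; first by rewrite dfwith_in.
by rewrite dfwith_out.
Qed.

Lemma regular_fusible_factor (i : I) :
  regular_fusible prodM -> regular_fusible (M i).
Proof.
move=> rfM a a_neq0; split=> //.
have a_single := dffun_single_neq0 (V := fun k => M k) i a a_neq0.
have [_ [r rN /fusible_dffun[[j fj] _]]] := rfM _ a_single.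
exists (r i); first by move=> riZ; apply: rN; apply/Zd_dffun; exists i.
move: fj; rewrite ract_dffunE; have [<-|ij] := eqVneq i j.
  by rewrite dffun_single_in.
by rewrite dffun_single_out // ract0l => /not_fusible0.
Qed.

Lemma regular_fusible_dffun :
    (forall i, exists y : M i, torsion_free y) ->
  (forall i, regular_fusible (M i)) -> regular_fusible prodM.
Proof.
move=> freeM rfM m m_neq0; split=> //.
have [i mi_neq0] := dffun_neq0 _ m_neq0.
have [_ [a aN fa]] := rfM i _ mi_neq0.
exists ([ffun j => dfwith (fun k => 1 : R k) a j] : prodR).
  move=> /Zd_dffun[j]; rewrite ffunE; have [<-|ij] := eqVneq i j.
    by rewrite dfwith_in.
  by rewrite dfwith_out // => /not_Zd1.
apply/fusible_dffun; split=> //.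
by exists i; rewrite ract_dffunE ffunE dfwith_in.
Qed.

End ProductTorsion.

Theorem corollary4 (n : nat) (R : 'I_n -> pzRingType)
    (M : forall i : 'I_n, rightModType (R i)) :
  let ringR : pzRingType := {dffun forall i : 'I_n, R i} in
  let modM : rightModType ringR := {dffun forall i : 'I_n, M i} in
  (regular_fusible modM -> forall i : 'I_n, regular_fusible (M i)) /\
  ((forall i : 'I_n, (1 : R i) <> 0 -> exists m : M i, m <> 0) ->
   (forall i : 'I_n, regular_fusible (M i)) -> regular_fusible modM).
Proof.
move=> ringR modM; split=> [rfM i | nontriv rfM].
  exact: regular_fusible_factor.
apply: regular_fusible_dffun => // i.
exact: regular_fusible_torsion_free (nontriv i) (rfM i).
Qed.
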